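(* One has $V_{\mathrm{It\hat o}}=\mathcal M^{\mathrm G}$.
   Context: Let $x_k,y_k$ ($k\in\mathbb N=\{0,1,\dots\}$) be commuting variables. For a monomial $m=\prod_kx_k^{a_k}\prod_ky_k^{b_k}$ put $((m))=\sum_ka_k$ and $[m]=\sum_k(1-k)a_k-\sum_k(1+k)b_k$. Let $\mathcal M^{\mathrm G}$ be the real linear span of the monomials $m$ with $[m]=1$, $((m))\ge2$ and $((m))$ even. For smooth $\Gamma,\sigma:\mathbb R\to\mathbb R$, $\Upsilon_{\Gamma,\sigma}$ is the linear map into $\mathcal C^\infty(\mathbb R,\mathbb R)$ with $\Upsilon_{\Gamma,\sigma}(m)(u)=\prod_k(\sigma^{(k)}(u))^{a_k}\prod_k(2\Gamma^{(k)}(u))^{b_k}$. $V_{\mathrm{It\hat o}}\subset\mathcal M^{\mathrm G}$ is the subspace generated by those $v\in\mathcal M^{\mathrm G}$ such that, for all smooth $\Gamma,\sigma,\bar\sigma:\mathbb R\to\mathbb R$, the equality $\sigma^2=\bar\sigma^2$ implies $\Upsilon_{\Gamma,\sigma}(v)=\Upsilon_{\Gamma,\bar\sigma}(v)$. *)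

(* Defs.v *)
From HB Require Import structures.
From mathcomp Require Import all_boot all_order all_algebra finmap.
From mathcomp Require Import boolp classical_sets functions reals topology.
From mathcomp Require Import normedtype derive.
(* The notations of monalg clash with those of mathcomp-analysis. *)
From mathcomp Require Import -(notations) monalg.

Set Implicit Arguments.
Unset Strict Implicit.
Unset Printing Implicit Defensive.

Import Order.TTheory GRing.Theory Num.Theory.
Import numFieldNormedType.Exports.

Local Open Scope ring_scope.
Local Open Scope classical_set_scope.

(* [inl k] stands for x_k and [inr k] for y_k. *)
Definition var : choiceType := (nat + nat)%type.

Definition mon : Type := cmonom var.

Definition polys (R : realType) : lmodType R := malg (cmonom var) R.

Definition is_x (i : var) : bool := if i is inl _ then true else false.

(* ((m)) *)
Definition xdeg (m : mon) : nat :=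
  (\sum_(i <- finsupp m | is_x i) m i)%N.

Definition var_weight (i : var) : int :=
  match i with
  | inl k => 1 - k%:Z
  | inr k => - (1 + k%:Z)
  end.

(* [m] *)
Definition weight (m : mon) : int :=
  \sum_(i <- finsupp m) var_weight i * (m i)%:Z.

Definition mon_poly (R : realType) (m : mon) : polys R := mkmalgU m 1.

Definition lspan (R : realType) (V : lmodType R) (S : set V) : set V :=
  [set v | exists (n : nat) (c : 'I_n -> R) (w : 'I_n -> V),
    (forall i, S (w i)) /\ v = \sum_(i < n) c i *: w i].

Definition MG (R : realType) : set (polys R) :=
  lspan [set v | exists m : mon,
    [/\ weight m = 1, (2 <= xdeg m)%N, ~~ odd (xdeg m) & v = mon_poly R m]].
Arguments MG R : clear implicits.

Definition smooth (R : realType) (f : R -> R) : Prop :=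
  forall (n : nat) (x : R), derivable (f^`(n)) x 1.

Definition Upsilon_var (R : realType) (Gam sig : R -> R) (i : var) (u : R) : R :=
  match i with
  | inl k => derive1n k sig u
  | inr k => 2 * derive1n k Gam u
  end.

Definition Upsilon_mon (R : realType) (Gam sig : R -> R) (m : mon) (u : R) : R :=
  \prod_(i <- finsupp m) Upsilon_var Gam sig i u ^+ m i.

(* The linear extension of [Upsilon_mon], defined on all polynomials; it is
   only used on [MG R]. *)
Definition Upsilon (R : realType) (Gam sig : R -> R) (v : polys R) : R -> R :=
  fun u => mmap idfun (fun m : mon => Upsilon_mon Gam sig m u) v.

Definition VIto (R : realType) : set (polys R) :=
  lspan [set v | MG R v /\
    forall Gam sig sig' : R -> R, smooth Gam -> smooth sig -> smooth sig' ->
      (forall u, sig u ^+ 2 = sig' u ^+ 2) ->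
      Upsilon Gam sig v = Upsilon Gam sig' v].
Arguments VIto R : clear implicits.

Lemma Upsilon_mon_poly (R : realType) (Gam sig : R -> R) (m : mon) :
  Upsilon Gam sig (mon_poly R m) = Upsilon_mon Gam sig m.
Proof. by apply/funext => u; rewrite /Upsilon mmapU /= mul1r. Qed.

Lemma Upsilon_linear (R : realType) (Gam sig : R -> R) :
  linear (Upsilon Gam sig : polys R -> (R -> R^o)).
Proof.
move=> a v w; apply/funext => u.
rewrite /Upsilon raddfD /=; congr (_ + _).
set h := fun m : mon => _; change (mmap idfun h (a *: v) = a * mmap idfun h v).
rewrite (mmapEw (msuppZ_le _ _)) mmapE big_distrr /=.
by apply: eq_bigr => m _; rewrite linearZ /= mulrA.
Qed.

Section SmoothTheory.
Context (R : realType).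
Implicit Types f g : R -> R.

Lemma derive1nSr n f : f^`(n.+1) = f^`()^`(n).
Proof. by rewrite /derive1n iterSr. Qed.

Let Cn (n : nat) f := forall k, (k <= n)%N -> forall x, derivable (f^`(k)) x 1.

Let CnS n f : Cn n.+1 f <-> (forall x, derivable f x 1) /\ Cn n f^`().
Proof.
split=> [H|[H0 H] [|k] // kn x]; last by rewrite derive1nSr; apply: H.
split=> [|k kn]; first exact: (H 0%N).
by rewrite -derive1nSr; apply: H.
Qed.

Let CnW n f : Cn n.+1 f -> Cn n f.
Proof. by move=> H k kn; apply: H; apply: leq_trans kn _. Qed.

Let CnD n f g : Cn n f -> Cn n g -> Cn n (f + g).
Proof.
elim: n f g => [|n IH] f g.
  move=> Hf Hg k; rewrite leqn0 => /eqP -> x.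
  by apply: derivableD; [exact: (Hf 0%N)|exact: (Hg 0%N)].
move=> /CnS[f0 f1] /CnS[g0 g1]; apply/CnS; split=> [x|].
  exact: derivableD.
suff -> : (f + g)^`() = derive1 f + derive1 g by exact: IH.
by apply/funext => x; rewrite derive1E deriveD // -!derive1E.
Qed.

Let CnM n f g : Cn n f -> Cn n g -> Cn n (f * g).
Proof.
elim: n f g => [|n IH] f g.
  move=> Hf Hg k; rewrite leqn0 => /eqP -> x.
  by apply: derivableM; [exact: (Hf 0%N)|exact: (Hg 0%N)].
move=> Hf Hg; have /CnS[f0 f1] := Hf; have /CnS[g0 g1] := Hg.
apply/CnS; split=> [x|]; first exact: derivableM.
suff -> : (f * g)^`() = f * derive1 g + g * derive1 f.
  by apply: CnD; apply: IH => //; exact: CnW.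
apply/funext => x; rewrite derive1E deriveM //.
by rewrite -!derive1E.
Qed.

Lemma smoothD f g : smooth f -> smooth g -> smooth (f + g).
Proof. by move=> Hf Hg n; apply: (@CnD n) => // k _. Qed.

Lemma smoothM f g : smooth f -> smooth g -> smooth (f * g).
Proof. by move=> Hf Hg n; apply: (@CnM n) => // k _. Qed.

Lemma smooth_cst (c : R) : smooth (cst c).
Proof.
move=> n; have [->|[d ->]] : (cst c : R -> R)^`(n) = cst c \/
    exists d, (cst c : R -> R)^`(n) = cst d.
- elim: n => [|n IH]; first by left.
  right; exists 0; rewrite derive1nS.
  by case: IH => [->|[d ->]]; apply/funext => x; rewrite derive1_cst.
- exact: derivable_cst.
- exact: derivable_cst.
Qed.

Let smooth0 : smooth (0 : R -> R).
Proof. by rewrite (_ : 0 = cst 0); [exact: smooth_cst|exact/funext]. Qed.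

Let smooth1 : smooth (1 : R -> R).
Proof. by rewrite (_ : 1 = cst 1); [exact: smooth_cst|exact/funext]. Qed.

Lemma smooth_derive1n n f : smooth f -> smooth (f^`(n)).
Proof. by move=> Hf k x; rewrite /derive1n -iterD; exact: Hf. Qed.

Lemma smoothX n f : smooth f -> smooth (f ^+ n).
Proof.
move=> Hf; elim: n => [|n IH]; first by rewrite expr0; exact: smooth1.
by rewrite exprS; apply: smoothM.
Qed.

Lemma Upsilon_smooth (Gam sig : R -> R) (v : polys R) :
  smooth Gam -> smooth sig -> smooth (Upsilon Gam sig v).
Proof.
move=> HG Hs; have Hvar i : smooth (Upsilon_var Gam sig i).
  case: i => k /=; first exact: smooth_derive1n.
  by apply: (@smoothM (cst 2)); [exact: smooth_cst|exact: smooth_derive1n].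
have Hmon m : smooth (Upsilon_mon Gam sig m).
  rewrite (_ : Upsilon_mon _ _ _ =
      \prod_(i <- finsupp m) (Upsilon_var Gam sig i ^+ m i)); last first.
    apply/funext => u; rewrite fct_prodE /Upsilon_mon.
    by apply: eq_bigr => i _; rewrite exprfctE.
  by elim/big_ind: _ => [|f g|i _];
    [exact: smooth1|exact: smoothM|exact: smoothX].
rewrite (_ : Upsilon Gam sig v =
    \sum_(m <- msupp v) (cst (mcoeff m v) * Upsilon_mon Gam sig m)); last first.
  by apply/funext => u; rewrite fct_sumE /Upsilon mmapE.
by elim/big_ind: _ => [|f g|m _];
  [exact: smooth0|exact: smoothD|apply: smoothM => //; exact: smooth_cst].
Qed.

End SmoothTheory.

(* Main.v *)
Require Import Defs.
From mathcomp Require Import all_boot all_order all_algebra.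
From mathcomp Require Import finmap boolp topology normedtype derive.
From mathcomp Require Import classical_sets reals.
From mathcomp Require Import -(notations) monalg.

(** The generators of [VIto R] lie in [MG R] by definition, so the content is
that each monomial [m] spanning [MG R] is itself a generator of [VIto R]
(lemma [Upsilon_mon_same_square]).

Let [sig] and [sig'] be smooth with the same square. If [sig' = s sig] near a
point [u] for some constant sign [s], then the k-th derivatives at [u] differ by
the same factor [s], and as [m] contains an even number of variables [x_k] the
signs cancel in the product (lemma [Upsilon_mon_near_sign]). Such a sign exists
near every point where [sig] does not vanish, by continuity
(lemma [near_sign_eq]), and trivially near every point of the interior of the
zero set of [sig], where both functions are zero. These two open sets together
are dense. On the remaining points no sign need exist: [sig] and [sig'] may
switch from equal to opposite across a zero of infinite order. There the
equality follows from the continuity of both sides. *)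

Set Implicit Arguments.
Unset Strict Implicit.
Unset Printing Implicit Defensive.

Import Order.TTheory GRing.Theory Num.Theory.
Import numFieldNormedType.Exports.

Local Open Scope ring_scope.
Local Open Scope classical_set_scope.

(** * Linear spans *)

Section Span.
Context (R : realType) (V : lmodType R).
Implicit Types S T : set V.

Lemma sub_lspan S : S `<=` lspan S.
Proof.
move=> v Sv; exists 1%N, (fun=> 1), (fun=> v); split=> //.
by rewrite big_ord1 scale1r.
Qed.

Lemma lspan0 S : lspan S 0.
Proof.
exists 0%N, (fun=> 0), (fun=> 0); split; first by case.
by rewrite big_ord0.
Qed.

Lemma lspanZ S a v : lspan S v -> lspan S (a *: v).
Proof.
move=> [n [c [w [Sw ->]]]]; exists n, (fun i => a * c i), w; split=> //.
by rewrite scaler_sumr; apply: eq_bigr => i _; rewrite scalerA.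
Qed.

Lemma lspanD S v v' : lspan S v -> lspan S v' -> lspan S (v + v').
Proof.
move=> [n [c [w [Sw ->]]]] [n' [c' [w' [Sw' ->]]]].
exists (n + n')%N,
  (fun i : 'I_(n + n') => match fintype.split i with inl j => c j | inr j => c' j end),
  (fun i : 'I_(n + n') => match fintype.split i with inl j => w j | inr j => w' j end).
split=> [i|]; first by case: fintype.split.
rewrite big_split_ord /=; congr (_ + _); apply: eq_bigr => i _.
  by rewrite (unsplitK (inl i)).
by rewrite (unsplitK (inr i)).
Qed.

Lemma lspan_min S T : S `<=` lspan T -> lspan S `<=` lspan T.
Proof.
move=> ST _ [n [c [w [Sw ->]]]].
elim/big_ind: _ => [|v v'|i _]; first exact: lspan0.
- exact: lspanD.
- exact: lspanZ (ST _ (Sw i)).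
Qed.

End Span.

(** * Functions with the same square *)

Section SameSquare.
Context (R : realType).
Implicit Types f g Gam sig : R -> R.

Lemma smooth_continuous f : smooth f -> continuous f.
Proof.
by move=> sf x; apply/differentiable_continuous/derivable1_diffP/(sf 0%N).
Qed.

(** The sum [g + s f] takes the nonzero value [2 s f x] at [x], so it stays
nonzero nearby and the other factor of [g ^ 2 - f ^ 2 = 0] has to vanish. *)
Lemma near_sign_eq f g x :
    continuous f -> continuous g -> (forall y, f y ^+ 2 = g y ^+ 2) ->
    f x != 0 ->
  exists2 s : R, s ^+ 2 = 1 & \forall y \near x, g y = s * f y.
Proof.
move=> cf cg fg fx0; pose s := g x / f x.
have gx : g x = s * f x by rewrite /s divfK.
have s2 : s ^+ 2 = 1 by rewrite /s expr_div_n -fg divff // expf_neq0.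
exists s => //.
have cvh : (fun y => g y + s * f y) @ x --> g x + s * f x.
  by apply: (cvgD (cg x)); apply: (cvgM (cvg_cst s) (cf x)).
have hx0 : g x + s * f x != 0.
  have gx0 : g x != 0 by rewrite -sqrf_eq0 -fg sqrf_eq0.
  by rewrite -gx -mulr2n mulrn_eq0.
apply: filterS (cvgr_neq0 _ cvh hx0) => y hy0.
apply/eqP; rewrite -subr_eq0 -(mulIr_eq0 _ (mulIf hy0)) -subr_sqr.
by rewrite exprMn s2 mul1r fg subrr.
Qed.

Lemma near_derive1n_scale n s f g x :
    smooth f -> (\forall y \near x, g y = s * f y) ->
  derive1n n g x = s * derive1n n f x.
Proof.
move=> sf.
(* The equality has to hold on a neighbourhood for the induction to pass to
   the next derivative. *)
suff H : (\forall y \near x, g y = s * f y) ->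
    \forall y \near x, derive1n n g y = s * derive1n n f y.
  by move=> /H /nbhs_singleton.
elim: n => [//|n IH] /IH /near_join near2; apply: filterS near2 => y gfy.
rewrite !derive1nS !derive1E.
rewrite (near_eq_derive 1
  (g := (s \*: (derive1n n f : R -> R^o)) : R -> R^o)) //.
by rewrite deriveZ //; exact: sf.
Qed.

(** Every factor coming from a variable [x_k] picks up [s], every factor coming
from a variable [y_k] is unchanged, hence the total factor is [s ^ xdeg m = 1].
*)
Lemma Upsilon_mon_near_sign Gam sig sig' (m : mon) s u :
    smooth sig -> s ^+ 2 = 1 -> ~~ odd (xdeg m) ->
    (\forall y \near u, sig' y = s * sig y) ->
  Upsilon_mon Gam sig' m u = Upsilon_mon Gam sig m u.
Proof.
move=> ssig s2 m_even near_sig.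
rewrite /Upsilon_mon (eq_bigr (fun i =>
    (if is_x i then s ^+ m i else 1) * Upsilon_var Gam sig i u ^+ m i)).
  rewrite big_split /= -big_mkcond /= -expr_sum -/(xdeg m).
  by rewrite -(even_halfK m_even) -mul2n exprM s2 expr1n mul1r.
case=> k _ /=; last by rewrite mul1r.
by rewrite (near_derive1n_scale k ssig near_sig) exprMn.
Qed.

(** The density argument, by contradiction: if the two sides differ at [u],
they differ on a neighbourhood of [u], so [sig] and [sig'] are proportional by
a sign near no point of it. Then [sig] vanishes on all of that neighbourhood,
and so does [sig'], which makes them equal there after all. *)
Lemma Upsilon_mon_same_square Gam sig sig' (m : mon) :
    smooth Gam -> smooth sig -> smooth sig' ->
    (forall u, sig u ^+ 2 = sig' u ^+ 2) -> ~~ odd (xdeg m) ->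
  Upsilon_mon Gam sig m = Upsilon_mon Gam sig' m.
Proof.
move=> sGam ssig ssig' sq m_even; apply/funext => u.
apply: contrapT => /eqP; rewrite -subr_eq0 => neq_u.
have cUps tau : smooth tau -> continuous (Upsilon_mon Gam tau m).
  move=> stau; rewrite -Upsilon_mon_poly.
  exact/smooth_continuous/Upsilon_smooth.
have cvd : (fun y => Upsilon_mon Gam sig m y - Upsilon_mon Gam sig' m y) @ u -->
    Upsilon_mon Gam sig m u - Upsilon_mon Gam sig' m u.
  by apply: cvgB; exact: cUps.
have no_sign y s : Upsilon_mon Gam sig m y - Upsilon_mon Gam sig' m y != 0 ->
    s ^+ 2 = 1 -> ~ \forall z \near y, sig' z = s * sig z.
  move=> neq_y s2 /(Upsilon_mon_near_sign Gam ssig s2 m_even) eq_y.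
  by rewrite eq_y subrr eqxx in neq_y.
apply: (no_sign u 1 neq_u (expr1n _ _)).
apply: filterS (cvgr_neq0 _ cvd neq_u) => y neq_y; rewrite mul1r.
have sig0 : sig y = 0.
  apply: contrapT => /eqP sigy.
  have [s s2] := near_sign_eq (smooth_continuous ssig) (smooth_continuous ssig')
    sq sigy.
  exact: no_sign.
by apply/eqP; rewrite sig0 -sqrf_eq0 -sq sig0 expr0n.
Qed.

End SameSquare.

Theorem proposition3p16 (R : realType) : VIto R = MG R.
Proof.
apply/seteqP; split; apply: lspan_min; first by move=> v [].
move=> _ [m [m_weight m_deg m_even ->]]; apply: sub_lspan; split.
  by apply: sub_lspan; exists m.
move=> Gam sig sig' sGam ssig ssig' sq; rewrite !Upsilon_mon_poly.
exact: Upsilon_mon_same_square.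
Qed.
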